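(* Let $(X,\pi)$ be a weighted $n$-partite simplicial complex and let $\vec s=(s(1),\dots,s(n))$ be any ordering of $[n]$; write $s(A)=\{s(a):a\in A\}$ and $[j+1,n]=\{j+1,\dots,n\}$. Then \[\mathrm{EC}\big(P^{(\vec s)}_{\mathrm{sq}}\big)\ge\prod_{j=1}^{n-1}\eta^{s([j+1,n])\to s(j)}.\]
   Context: An $n$-partite simplicial complex $X$ is a downward-closed family of subsets of a finite vertex set whose inclusion-maximal faces all have size $n$, with vertices partitioned into sides $X[1],\dots,X[n]$ such that each face $\omega\in X^{(n)}$ of size $n$ contains exactly one vertex $\omega_i$ per side; $\omega_T=\{\omega_t:t\in T\}$. $\mathrm{typ}(\alpha)=\{i:\alpha\cap X[i]\ne\emptyset\}$, $X[T]$ = faces of type $T$, $\alpha\oplus\beta$ = union of faces of disjoint types. $\pi$ is a full-support probability distribution on $X^{(n)}$. For a face $\alpha$ of type $S$ and $T\subseteq[n]\setminus S$: $X_\alpha[T]=\{\tau\in X[T]:\alpha\oplus\tau\in X\}$ and $\pi^{(\alpha)}_T(\tau)=\Pr_{\omega\sim\pi}[\omega_T=\tau\mid\omega_S=\alpha]$. For disjoint $I,J\subseteq[n]\setminus\mathrm{typ}(\alpha)$, $C^{I\to J}_\alpha(\tau_I,\tau_J)=\pi^{(\alpha\oplus\tau_I)}_J(\tau_J)$ ($\tau_I\in X_\alpha[I],\tau_J\in X_\alpha[J]$). KL divergence: $D(\mu\|\nu)=\sum_x\mu(x)\log\frac{\mu(x)}{\nu(x)}$. For disjoint $I,J\subseteq[n]$,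 $\eta^{I\to J}=1-\kappa^{I\to J}$ where $\kappa^{I\to J}=\max\{D(\mu C^{I\to J}_\alpha\|\pi^{(\alpha)}_J)/D(\mu\|\pi^{(\alpha)}_I):\alpha\in X[[n]\setminus(I\cup J)],\ \mu$ a probability distribution on $X_\alpha[I]$ with $D(\mu\|\pi_I^{(\alpha)})\neq0\}$ (singletons written without braces). Update operators: $Q_i(\omega,\omega')=\Pr_{\bar\omega\sim\pi}[\bar\omega=\omega'\mid\bar\omega_{[n]\setminus\{i\}}=\omega_{[n]\setminus\{i\}}]$ on $X^{(n)}$; sequential sweep $P^{(\vec s)}_{\mathrm{sq}}=Q_{s(1)}\cdots Q_{s(n)}$ (distributions are row vectors acting on the left). For a Markov operator $P$ with stationary distribution $\pi$, the entropy contraction factor is $\mathrm{EC}(P)=1-\max\{D(\mu P\|\pi)/D(\mu\|\pi):\mu$ a probability distribution on $X^{(n)}$, $D(\mu\|\pi)\ne0\}$. *)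

(* Defs.v *)
From HB Require Import structures.
From mathcomp Require Import all_boot all_order all_algebra.
From mathcomp Require Import perm reals exp.

Set Implicit Arguments.
Unset Strict Implicit.
Unset Printing Implicit Defensive.

Import Order.TTheory GRing.Theory Num.Theory.
Local Open Scope ring_scope.

(** * Distributions, kernels and KL divergence on a finite type *)

(* A distribution on a subset [A] of a finite type is represented by a
   real-valued function on the whole type that vanishes outside [A]; sums over
   [A] may therefore be taken over the whole type. *)
Definition distr_on (R : realType) (T : finType) (A : {set T}) (mu : T -> R) :
    Prop :=
  [/\ forall x, 0 <= mu x,
      forall x, x \notin A -> mu x = 0
    & \sum_(x in A) mu x = 1].

(* The row-vector action of a kernel. *)
Definition push (R : realType) (S T : finType) (mu : S -> R) (P : S -> T -> R) :
    T -> R :=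
  fun y => \sum_x mu x * P x y.

Definition kcomp (R : realType) (T : finType) (P Q : T -> T -> R) :
    T -> T -> R :=
  fun x => push (P x) Q.

Definition kid (R : realType) (T : finType) : T -> T -> R :=
  fun x y => (x == y)%:R.

(* Terms with [mu x = 0] vanish (0 log 0 = 0).  This is the usual divergence
   when [mu] is absolutely continuous with respect to [nu]. Every use below is
   of that kind: the second argument is positive on the set that carries the
   first one. *)
Definition KL (R : realType) (T : finType) (mu nu : T -> R) : R :=
  \sum_x mu x * ln (mu x / nu x).

(** * Weighted partite complexes *)

(* The partition of the vertices into sides is given by [side]: the i-th side
   is the fibre over [i]. *)
Record partite_complex (n : nat) (V : finType) := PartiteComplex {
  side : V -> 'I_n;
  faces : {set {set V}};
  faces_down : forall a b : {set V}, b \in faces -> a \subset b -> a \in faces;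
  faces_pure : forall w : {set V},
    maxset (fun a => a \in faces) w -> #|w| = n;
  faces_partite : forall w : {set V}, w \in faces -> #|w| = n ->
    forall i : 'I_n, #|[set v in w | side v == i]| = 1%N
}.

Section Complex.
Variables (n : nat) (V : finType) (X : partite_complex n V).

Definition facets : {set {set V}} := [set w in faces X | #|w| == n].

Definition side_set (i : 'I_n) : {set V} := [set v | side X v == i].

Definition typ (a : {set V}) : {set 'I_n} :=
  [set i | a :&: side_set i != set0].

Definition faces_of (T : {set 'I_n}) : {set {set V}} :=
  [set a in faces X | typ a == T].

(* [restr w T] is $\omega_T$. *)
Definition restr (w : {set V}) (T : {set 'I_n}) : {set V} :=
  [set v in w | side X v \in T].

(* $X_\alpha[T]$, meant for [T] disjoint from [typ a]. *)
Definition link_of (a : {set V}) (T : {set 'I_n}) : {set {set V}} :=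
  [set t in faces_of T | a :|: t \in faces X].

End Complex.

Record weighted_complex (R : realType) (n : nat) (V : finType) :=
  WeightedComplex {
    complex :> partite_complex n V;
    weight : {set V} -> R;
    weight_distr : distr_on (facets complex) weight;
    weight_full : forall w, w \in facets complex -> 0 < weight w
  }.

Section Weighted.
Variables (R : realType) (n : nat) (V : finType) (X : weighted_complex R n V).

Definition Pr (E : pred {set V}) : R :=
  \sum_(w in facets X | E w) weight X w.

Definition cPr (E F : pred {set V}) : R :=
  Pr (fun w => E w && F w) / Pr F.

(* $\pi^{(\alpha)}_T$ *)
Definition marg (a : {set V}) (T : {set 'I_n}) : {set V} -> R :=
  fun t => cPr (fun w => restr X w T == t) (fun w => restr X w (typ X a) == a).

(* $C^{I\to J}_\alpha$; the source type [I] is that of the argument [ti]. *)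
Definition colored_walk (a : {set V}) (J : {set 'I_n}) :
    {set V} -> {set V} -> R :=
  fun ti tj => marg (a :|: ti) J tj.

(* The maximum is read as a supremum, since it may be approached only as [mu]
   tends to the reference distribution.  The ratios lie in [0, 1] by the
   data-processing inequality.  If no [mu] qualifies, [sup] gives 0, which is
   the least contraction constant in that case. *)
Definition kappa_of (I J : {set 'I_n}) : R :=
  sup (fun r : R => exists (a : {set V}) (mu : {set V} -> R),
    [/\ a \in faces_of X (~: (I :|: J)),
        distr_on (link_of X a I) mu,
        KL mu (marg a I) != 0
      & r = KL (push mu (colored_walk a J)) (marg a J) / KL mu (marg a I)]).

Definition eta_of (I J : {set 'I_n}) : R := 1 - kappa_of I J.

Definition update (i : 'I_n) : {set V} -> {set V} -> R :=
  fun w w' =>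
    cPr (fun u => u == w')
        (fun u => restr X u (~: [set i]) == restr X w (~: [set i])).

(* $Q_{s(1)} \cdots Q_{s(n)}$, with 0-based positions. *)
Definition seq_sweep (s : {perm 'I_n}) : {set V} -> {set V} -> R :=
  \big[@kcomp R {set V} / @kid R {set V}]_(j < n) update (s j).

(* Same reading of the maximum as in [kappa_of]. *)
Definition EC (P : {set V} -> {set V} -> R) : R :=
  1 - sup (fun r : R => exists mu : {set V} -> R,
    [/\ distr_on (facets X) mu,
        KL mu (weight X) != 0
      & r = KL (push mu P) (weight X) / KL mu (weight X)]).

End Weighted.

(* Main.v *)
(* Write mu = f pi.  The density of mu Q_i is the conditional expectation of f
   given the coordinates other than i, and divergences become sums of
   pi f ln f, so that no conditioning is needed until the constants eta
   enter.  With A the set of coordinates already updated, one shows by downward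
   induction on A that the remaining sweep contracts Ent(f | A) by
   1 minus the product of the remaining eta's.  Updating coordinate i does not
   increase Ent(f | A), and makes f a function of A and the set I of coordinates
   not yet reached; then Ent(f | A) splits by the chain rule into the part
   carried by i given A, which is at most kappa^{I -> i} times the whole
   (fibrewise over the faces of type A), and Ent(f | A + i), on which the
   induction hypothesis applies. *)
Require Import Defs.
From HB Require Import structures.
From mathcomp Require Import all_boot all_order all_algebra.
From mathcomp Require Import perm reals exp.
From mathcomp Require Import ring lra zify.

Set Implicit Arguments.
Unset Strict Implicit.
Unset Printing Implicit Defensive.

Import Order.TTheory GRing.Theory Num.Theory.
Local Open Scope ring_scope.

(** * Bounds on suprema, and composition of kernels *)

Lemma sup_le_nonneg (R : realType) (E : R -> Prop) (c : R) :
  0 <= c -> (forall r, E r -> r <= c) -> sup E <= c.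
Proof.
move=> c0 Ec; have [nE|noE] := boolp.pselect (exists r, E r).
  by apply: ge_sup => // r /Ec.
(* The empty set has the default supremum 0; this is where [0 <= c] enters. *)
by rewrite sup_out // => -[].
Qed.

Lemma sup_ge0_nonneg (R : realType) (E : R -> Prop) :
  (forall r, E r -> 0 <= r) -> 0 <= sup E.
Proof.
move=> E0; have [[[r Er] ubE]|noE] := boolp.pselect (classical_sets.has_sup E).
  by apply: le_trans (E0 r Er) _; exact: ub_le_sup.
by rewrite sup_out.
Qed.

Lemma push_kcomp (R : realType) (T : finType) (mu : T -> R) (P Q : T -> T -> R) y :
  push mu (kcomp P Q) y = push (push mu P) Q y.
Proof.
rewrite /push /kcomp /push.
transitivity (\sum_x \sum_z mu x * P x z * Q z y).
  by apply: eq_bigr => x _; rewrite mulr_sumr; apply: eq_bigr => z _; rewrite mulrA.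
by rewrite exchange_big; apply: eq_bigr => z _; rewrite mulr_suml.
Qed.

(** * Conditional expectation and x ln x on a finite weighted set *)

Section CondExp.
Variables (R : realType) (T : finType) (p : T -> R).
Hypothesis p_ge0 : forall w, 0 <= p w.

(** On a fibre of [k] of mass zero the quotient takes the default value 0. *)
Definition condexp (K : eqType) (k : T -> K) (f : T -> R) (w : T) : R :=
  (\sum_(u | k u == k w) p u * f u) / (\sum_(u | k u == k w) p u).

Definition xlnx (x : R) : R := x * ln x.

Definition xlnx_sum (B : pred T) (f : T -> R) : R :=
  \sum_(w | B w) p w * xlnx (f w).

Lemma psum_eq0 (B : pred T) : \sum_(u | B u) p u = 0 -> forall u, B u -> p u = 0.
Proof.
move=> h u Bu.
by have := psumr_eq0P (fun i (_ : B i) => p_ge0 i) h => /(_ u Bu).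
Qed.

Lemma condexp_ge0 (K : eqType) (k : T -> K) (f : T -> R) w :
  (forall u, 0 <= f u) -> 0 <= condexp k f w.
Proof.
by move=> f0; apply: divr_ge0; apply: sumr_ge0 => u _ //; apply: mulr_ge0.
Qed.

Lemma condexp_fibre (K : eqType) (k : T -> K) (f : T -> R) u w :
  k u = k w -> condexp k f u = condexp k f w.
Proof. by rewrite /condexp => ->. Qed.

(** Both sides are sums over pairs in a common fibre of [k], where [H] is constant; exchanging the
    two summations cancels the mass of the fibre. *)
Lemma condexp_avg (K : eqType) (k : T -> K) (f H : T -> R) :
  (forall u w, k u = k w -> H u = H w) ->
  \sum_w p w * (H w * condexp k f w) = \sum_w p w * (H w * f w).
Proof.
move=> Hk; pose Z w := \sum_(u | k u == k w) p u.
have ZE u w : k u = k w -> Z u = Z w by rewrite /Z => ->.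
transitivity (\sum_w \sum_(u | k u == k w) p w * (H u * (p u * f u) / Z u)).
  apply: eq_bigr => w _; rewrite /condexp -/(Z w) mulr_suml mulr_sumr mulr_sumr.
  by apply: eq_bigr => u /eqP e; rewrite (ZE _ _ e) (Hk _ _ e) !mulrA.
rewrite (exchange_big_dep xpredT) //=; apply: eq_bigr => u _.
rewrite -mulr_suml (eq_bigl (fun w => k w == k u)); last by move=> w; rewrite eq_sym.
(* In a fibre of mass zero [p u] itself is 0, so the default value of [condexp] does no harm. *)
rewrite -/(Z u); have [Zu0|Zu0] := eqVneq (Z u) 0.
  by rewrite Zu0 !mul0r (psum_eq0 Zu0) ?mul0r.
by field.
Qed.

Lemma condexp_sum (K : eqType) (k : T -> K) (B : pred T) (f : T -> R) :
  (forall u w, k u = k w -> B u = B w) ->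
  \sum_(w | B w) p w * condexp k f w = \sum_(w | B w) p w * f w.
Proof.
move=> Bk; have mk (g : T -> R) : \sum_(w | B w) p w * g w
    = \sum_w p w * ((B w)%:R * g w).
  rewrite big_mkcond; apply: eq_bigr => w _.
  by case: (B w); rewrite ?mul1r // mul0r mulr0.
by rewrite !mk; apply: condexp_avg => u w /Bk ->.
Qed.

(** A fibre of [k] is a union of fibres of [k'], and on such sets [condexp_sum] applies to the
    numerator. *)
Lemma condexp_tower (K K' : eqType) (k : T -> K) (k' : T -> K') (f : T -> R) w :
  (forall u v, k' u = k' v -> k u = k v) ->
  condexp k (condexp k' f) w = condexp k f w.
Proof.
move=> kk'; rewrite /condexp -/(condexp k' f); congr (_ / _).
by apply: condexp_sum => u v /kk' ->.
Qed.

(** Convexity of x ln x: the graph lies above its tangent at [y]. For [x > 0] this is ln(1 + z) <= z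
    at z = y/x - 1, multiplied by [x]. *)
Lemma xlnx_tangent (x y : R) : 0 <= x -> 0 < y ->
  xlnx y + (ln y + 1) * (x - y) <= xlnx x.
Proof.
rewrite /xlnx le_eqVlt => /orP[/eqP <-|x0] y0; first by nra.
have : ln (1 + (y / x - 1)) <= y / x - 1.
  by apply: le_ln1Dx; have := divr_gt0 y0 x0; lra.
rewrite addrC subrK ln_div ?posrE // => h.
have := ler_wpM2l (ltW x0) h.
have -> : x * (y / x - 1) = y - x by field; rewrite gt_eqF.
move=> {}h; lra.
Qed.

Lemma xlnx0 : xlnx 0 = 0. Proof. by rewrite /xlnx mul0r. Qed.

Lemma xlnx1 : xlnx 1 = 0. Proof. by rewrite /xlnx ln1 mulr0. Qed.

Lemma condexp_eq0 (K : eqType) (k : T -> K) (f : T -> R) w :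
  (forall u, 0 <= f u) -> condexp k f w = 0 ->
  forall u, k u = k w -> p u * f u = 0.
Proof.
move=> f0 + u uw; rewrite /condexp => /eqP; rewrite mulf_eq0 invr_eq0.
move=> /orP[|] /eqP h; last by rewrite (psum_eq0 h) ?uw ?mul0r.
apply: (psumr_eq0P _ h); last by rewrite uw.
by move=> i _; apply: mulr_ge0.
Qed.

(** Conditional Jensen inequality. At each [w] the tangent of x ln x is taken at [g w]; its slope
    depends only on the fibre, so by [condexp_avg] the linear term sums to zero. *)
Lemma xlnx_sum_condexp (K : eqType) (k : T -> K) (B : pred T) (f : T -> R) :
  (forall u w, k u = k w -> B u = B w) -> (forall u, 0 <= f u) ->
  xlnx_sum B (condexp k f) <= xlnx_sum B f.
Proof.
move=> Bk f0; set g := condexp k f.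
pose H w := (B w)%:R * (ln (g w) + 1).
have Hk u w : k u = k w -> H u = H w.
  by move=> e; rewrite /H /g (Bk _ _ e) (condexp_fibre _ e).
have avg := condexp_avg f Hk.
rewrite -subr_ge0 /xlnx_sum -sumrB big_mkcond /=.
(* Zero is written as the total of the linear terms, after which the inequality can be checked term
   by term. *)
rewrite -[leLHS](subrr (\sum_w p w * (H w * f w))) -{2}avg -sumrB.
apply: ler_sum => w _; rewrite /H -/(g w); case: (B w); last first.
  by rewrite !mul0r mulr0 subrr.
rewrite !mul1r.
have g0 : 0 <= g w := condexp_ge0 _ _ f0.
(* There is no tangent at [g w = 0], but then [p w * f w = 0] and the term is trivial. *)
move: g0; rewrite le_eqVlt => /orP[/eqP|] gw.
  have := condexp_eq0 f0 (esym gw) (erefl (k w)); rewrite -/g -gw => /eqP.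
  rewrite mulf_eq0 => /orP[|] /eqP ->; rewrite ?xlnx0; lra.
have := ler_wpM2l (p_ge0 w) (xlnx_tangent (f0 w) gw); nra.
Qed.

Lemma xlnxZ (c x : R) : 0 <= c -> 0 <= x -> xlnx (c * x) = c * xlnx x + xlnx c * x.
Proof.
rewrite !le_eqVlt => /orP[/eqP <-|c0] /orP[/eqP <-|x0];
  rewrite ?(mul0r, mulr0, xlnx0, addr0) //.
by rewrite /xlnx lnM ?posrE //; ring.
Qed.

Lemma condexpZ (K : eqType) (k : T -> K) (c : R) (f : T -> R) w :
  condexp k (fun u => c * f u) w = c * condexp k f w.
Proof.
rewrite /condexp mulrA mulr_sumr; congr (_ / _).
by apply: eq_bigr => u _; rewrite mulrCA.
Qed.

Lemma eq_condexp (K : eqType) (k : T -> K) (f g : T -> R) w :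
  (forall u, k u = k w -> f u = g u) -> condexp k f w = condexp k g w.
Proof.
by move=> fg; congr (_ / _); apply: eq_bigr => u /eqP /fg ->.
Qed.

Lemma xlnx_sumZ (B : pred T) (c : R) (f : T -> R) :
  0 <= c -> (forall u, 0 <= f u) ->
  xlnx_sum B (fun w => c * f w)
  = c * xlnx_sum B f + xlnx c * \sum_(w | B w) p w * f w.
Proof.
move=> c0 f0; rewrite /xlnx_sum !mulr_sumr -big_split /=.
by apply: eq_bigr => w _; rewrite xlnxZ //; ring.
Qed.

(** Where [nu] vanishes so does [mu], and both summands are 0; elsewhere [nu] cancels in the
    logarithm. *)
Lemma KL_density (mu nu f : T -> R) :
  (forall x, mu x = nu x * f x) -> KL mu nu = \sum_x nu x * xlnx (f x).
Proof.
move=> e; apply: eq_bigr => x _; rewrite e /xlnx.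
have [->|nx] := eqVneq (nu x) 0; first by rewrite !mul0r.
by rewrite mulrA [nu x * f x / _]mulrAC divff // mul1r.
Qed.

End CondExp.

(** * Types and restrictions of faces *)

Section Restriction.
Variables (n : nat) (V : finType) (X : partite_complex n V).
Implicit Types (a b t w : {set V}) (S T : {set 'I_n}).

Lemma in_typ a i : reflect (exists2 v, v \in a & side X v = i) (i \in typ X a).
Proof.
rewrite inE; apply: (iffP (set0Pn _)) => [[v]|[v va vi]].
  by rewrite !inE => /andP[va /eqP vi]; exists v.
by exists v; rewrite !inE va vi eqxx.
Qed.

Lemma typU a b : typ X (a :|: b) = typ X a :|: typ X b.
Proof.
apply/setP => i; rewrite [in RHS]inE; apply/in_typ/orP => [[v]|[]/in_typ[v v_ vi]].
- by rewrite inE => /orP[] v_ vi; [left|right]; apply/in_typ; exists v.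
- by exists v; rewrite // inE v_.
- by exists v; rewrite // inE v_ orbT.
Qed.

Lemma restr_sub w T : restr X w T \subset w.
Proof. by apply/subsetP => v; rewrite inE => /andP[]. Qed.

Lemma restrT w : restr X w setT = w.
Proof. by apply/setP => v; rewrite !inE andbT. Qed.

Lemma restr0 w : restr X w set0 = set0.
Proof. by apply/setP => v; rewrite !inE andbF. Qed.

Lemma restrU w S T : restr X w (S :|: T) = restr X w S :|: restr X w T.
Proof. by apply/setP => v; rewrite !inE andb_orr. Qed.

Lemma setU_restr a b T : restr X (a :|: b) T = restr X a T :|: restr X b T.
Proof. by apply/setP => v; rewrite !inE andb_orl. Qed.

Lemma restr_restr w S T : S \subset T -> restr X (restr X w T) S = restr X w S.
Proof.
move=> /subsetP ST; apply/setP => v; rewrite !inE -andbA; congr (_ && _).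
by case vS: (side X v \in S); rewrite ?andbF // ST.
Qed.

Lemma restr_mono u w S T :
  S \subset T -> restr X u T = restr X w T -> restr X u S = restr X w S.
Proof. by move=> ST e; rewrite -(restr_restr u ST) e restr_restr. Qed.

Lemma restr_id a T : typ X a \subset T -> restr X a T = a.
Proof.
move=> /subsetP aT; apply/setP => v; rewrite !inE; case va: (v \in a) => //=.
by apply: aT; apply/in_typ; exists v.
Qed.

Lemma restr_disjoint a T : [disjoint typ X a & T] -> restr X a T = set0.
Proof.
move=> dis; apply/setP => v; rewrite !inE; apply/negP => /andP[va vT].
have /(disjointFr dis) : side X v \in typ X a by apply/in_typ; exists v.
by rewrite vT.
Qed.

Lemma restr_setU_eq w a t (A I : {set 'I_n}) :
  typ X a = A -> typ X t = I -> [disjoint A & I] ->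
  (restr X w (A :|: I) == a :|: t) = (restr X w A == a) && (restr X w I == t).
Proof.
move=> aA tI dis; apply/eqP/andP => [e|[/eqP <- /eqP <-]]; last exact: restrU.
rewrite -(restr_restr w (subsetUl A I)) -(restr_restr w (subsetUr A I)) e.
rewrite !setU_restr (restr_id (a := a) (T := A)) ?aA //.
rewrite (restr_id (a := t) (T := I)) ?tI //.
rewrite (restr_disjoint (a := a)) ?aA // (restr_disjoint (a := t)) ?tI.
  by rewrite setU0 set0U !eqxx.
by rewrite disjoint_sym.
Qed.

Lemma facet_face w : w \in facets X -> w \in faces X.
Proof. by rewrite inE => /andP[]. Qed.

Lemma facet_side w i : w \in facets X -> exists v, [set u in w | side X u == i] = [set v].
Proof.
rewrite inE => /andP[wX /eqP wn].
by apply/cards1P; rewrite (faces_partite wX wn).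
Qed.

Lemma typ_restr w T : w \in facets X -> typ X (restr X w T) = T.
Proof.
move=> wF; apply/setP => i; apply/in_typ/idP => [[v]|iT].
  by rewrite inE => /andP[_ vT] <-.
have [v /setP/(_ v)] := facet_side i wF; rewrite !inE eqxx => /andP[vw /eqP vi].
by exists v => //; rewrite inE vw vi.
Qed.

Lemma restr_faces_of w T : w \in facets X -> restr X w T \in faces_of X T.
Proof.
move=> wF; rewrite inE typ_restr // eqxx andbT.
exact: faces_down (facet_face wF) (restr_sub _ _).
Qed.

(** A facet has a single vertex on each side, so its vertex on a side met by [b] must be the one in
    [b]. *)
Lemma restr_typ w b : w \in facets X -> b \subset w -> restr X w (typ X b) = b.
Proof.
move=> wF /subsetP bw; apply/setP => v; rewrite inE.
apply/andP/idP => [[vw /in_typ[u ub uv]]|vb]; last first.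
  by split; [exact: bw | apply/in_typ; exists v].
have [x e] := facet_side (side X v) wF.
have : v \in [set u in w | side X u == side X v] by rewrite inE vw /=.
have : u \in [set u in w | side X u == side X v] by rewrite inE uv bw /=.
by rewrite e !inE => /eqP ux /eqP ->; rewrite -ux.
Qed.

Lemma face_facet b : b \in faces X -> exists2 w, w \in facets X & b \subset w.
Proof.
move=> bX; have [w wmax bw] := maxset_exists (P := fun a => a \in faces X) bX.
exists w => //; rewrite inE (faces_pure wmax) eqxx andbT.
by have /maxsetP[] := wmax.
Qed.

End Restriction.

(** * Marginals of links as sums over facets *)

Section Weighted.
Variables (R : realType) (n : nat) (V : finType) (X : weighted_complex R n V).
Implicit Types (a t w : {set V}) (A I J T : {set 'I_n}) (f h : {set V} -> R).
Local Notation p := (weight X).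

Lemma weight_ge0 w : 0 <= p w.
Proof. by have [] := weight_distr X. Qed.

Lemma weight_notin w : w \notin facets X -> p w = 0.
Proof. by have [] := weight_distr X => _ + _; apply. Qed.

Lemma weight_neq0 w : p w != 0 -> w \in facets X.
Proof. by apply: contraR => /weight_notin ->. Qed.

Lemma weight_sum : \sum_w p w = 1.
Proof.
have [_ _ <-] := weight_distr X; rewrite [RHS]big_mkcond /=.
by apply: eq_bigr => w _; case: ifPn => // /weight_notin.
Qed.

Lemma PrE (E : pred {set V}) : Pr X E = \sum_(w | E w) p w.
Proof.
rewrite /Pr [LHS]big_mkcond [RHS]big_mkcond /=; apply: eq_bigr => w _.
by have [wF|/weight_notin ->] := boolP (w \in _) => //=; case: ifP.
Qed.

(** The event $\omega_S=\alpha$ on which $\pi^{(\alpha)}$ is conditioned. *)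
Definition block a (w : {set V}) : bool := restr X w (typ X a) == a.

Definition block_mass a : R := \sum_(w | block a w) p w.

Lemma block_mass_gt0 a : a \in faces X -> 0 < block_mass a.
Proof.
move=> /face_facet[w wF aw]; rewrite /block_mass (bigD1 w) /=; last first.
  by rewrite /block restr_typ.
rewrite ltr_wpDr ?weight_full //; apply: sumr_ge0 => u _; exact: weight_ge0.
Qed.

Lemma margE a T t :
  marg X a T t = (\sum_(w | block a w && (restr X w T == t)) p w) / block_mass a.
Proof.
rewrite /marg /cPr !PrE; congr (_ / _).
by apply: eq_bigl => w; rewrite andbC.
Qed.

Lemma marg_sum a T (F : {set V} -> R) : a \in faces X ->
  block_mass a * (\sum_t marg X a T t * F t)
  = \sum_(w | block a w) p w * F (restr X w T).
Proof.
move=> aX; have Z0 := block_mass_gt0 aX.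
rewrite [RHS](partition_big (fun w => restr X w T) predT) //= mulr_sumr.
apply: eq_bigr => t _; rewrite margE.
rewrite mulrA [_ * (_ / _)]mulrC divfK ?gt_eqF // mulr_suml.
by apply: eq_bigr => w /andP[_ /eqP ->].
Qed.

(** Multiplication by the block mass removes the conditioning: divergences on the link of [a] become
    sums of x ln x over the block, comparable by conditional Jensen. *)
Lemma KL_marg a T h mu : a \in faces X ->
  (forall t, mu t = marg X a T t * h t) ->
  block_mass a * KL mu (marg X a T)
  = xlnx_sum p (block a) (fun w => h (restr X w T)).
Proof. by move=> aX e; rewrite (KL_density e) marg_sum. Qed.

(** Product rule: the right side is the joint probability of $\omega_I=t$ and $\omega_J=x$ given
    $\omega_S=\alpha$. *)
Lemma marg_colored_walk I J a t x : [disjoint I & J] ->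
  a \in faces_of X (~: (I :|: J)) ->
  marg X a I t * colored_walk X a J t x
  = (\sum_(w | [&& block a w, restr X w J == x & restr X w I == t]) p w)
    / block_mass a.
Proof.
move=> dis; rewrite inE => /andP[aX /eqP aT].
pose N := \sum_(w | block a w && (restr X w I == t)) p w.
rewrite margE -/N; have [N0|N0] := eqVneq N 0.
  rewrite N0 !mul0r big1 ?mul0r // => w /and3P[bw _ wt].
  by apply: (psum_eq0 weight_ge0 N0); rewrite bw wt.
(* A [t] of positive probability is the restriction to [I] of some facet. Its type is needed to
   split the event for [a :|: t] into those for [a] and [t]. *)
have tI : typ X t = I.
  have [w /andP[/andP[_ /eqP <-] /weight_neq0]|no] :=
    pickP (fun w => block a w && (restr X w I == t) && (p w != 0)).
    exact: typ_restr.
  case/eqP: N0; apply: big1 => w bw; apply/eqP.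
  by have := no w; rewrite bw /= => /negbFE.
have bE w : block (a :|: t) w = block a w && (restr X w I == t).
  rewrite /block typU aT tI; apply: restr_setU_eq => //.
  by rewrite disjoints_subset setCS subsetUl.
rewrite /colored_walk margE /block_mass.
rewrite (eq_bigl _ _ bE) -/N mulrAC; congr (_ / _).
rewrite mulrC divfK //; apply: eq_bigl => w.
by rewrite bE -andbA; congr (_ && _); rewrite andbC.
Qed.

Lemma restr_eqU w v S T :
  (restr X w (S :|: T) == restr X v (S :|: T))
  = (restr X w S == restr X v S) && (restr X w T == restr X v T).
Proof.
apply/eqP/andP => [e|[/eqP e1 /eqP e2]]; last by rewrite !restrU e1 e2.
by split; apply/eqP; apply: restr_mono e; [exact: subsetUl | exact: subsetUr].
Qed.

Lemma setC_sub_disjoint I J : [disjoint I & J] -> ~: I = ~: (I :|: J) :|: J.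
Proof.
move=> dis; apply/setP => i; rewrite !inE.
by have [/(disjointFl dis) ->|] := boolP (i \in J); rewrite ?orbF ?orbT.
Qed.

(** The pushed measure has as density the mean of [h] given [a] and $\omega_J$. Since the complement
    of [I] is [typ X a] together with [J], inside the block this is conditioning on all coordinates
    outside [I]. *)
Lemma KL_push_colored_walk I J a h mu : [disjoint I & J] ->
  a \in faces_of X (~: (I :|: J)) ->
  (forall t, mu t = marg X a I t * h t) ->
  block_mass a * KL (push mu (colored_walk X a J)) (marg X a J)
  = xlnx_sum p (block a)
      (condexp p (fun w => restr X w (~: I)) (fun w => h (restr X w I))).
Proof.
move=> dis aA muE; have := aA; rewrite inE => /andP[aX /eqP aT].
have Z0 := block_mass_gt0 aX.
pose B (x w : {set V}) := block a w && (restr X w J == x).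
pose K (x : {set V}) := (\sum_(w | B x w) p w * h (restr X w I)) / (\sum_(w | B x w) p w).
rewrite (KL_marg (h := K) aX) => [|x].
  apply: eq_bigr => w bw; congr (_ * xlnx _); rewrite /K /condexp.
  have e u : B (restr X w J) u = (restr X u (~: I) == restr X w (~: I)).
    move/eqP: bw; rewrite aT => ew.
    by rewrite (setC_sub_disjoint dis) restr_eqU ew /B /block aT.
  by rewrite !(eq_bigl _ _ e).
transitivity ((\sum_(w | B x w) p w * h (restr X w I)) / block_mass a).
  rewrite [in RHS](partition_big (fun w => restr X w I) predT) //= mulr_suml.
  apply: eq_bigr => t _; rewrite muE mulrAC marg_colored_walk // mulrAC.
  congr (_ / _); rewrite mulr_suml.
  apply: eq_big => [w|w /and3P[_ _ /eqP ->] //].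
  by rewrite /B andbA.
(* If the event [B x] has mass zero, [K x] is a default value, but the numerator vanishes too. *)
rewrite margE -/(B x) /K; set N := (X in X / _ = _).
set D := \sum_(w | B x w) p w; have [D0|D0] := eqVneq D 0; last first.
  by rewrite [RHS]mulrC -/N mulrA divfK.
rewrite D0 !mul0r /N big1 ?mul0r // => w bw.
by rewrite (psum_eq0 weight_ge0 D0 bw) mul0r.
Qed.

(** Some facet contains [a :|: t], and by full support it has positive weight. Hence measures on the
    link have densities. *)
Lemma link_marg_gt0 I a t : t \in link_of X a I -> 0 < marg X a I t.
Proof.
rewrite !inE => /andP[/andP[tX /eqP tI] atX].
have [w wF atw] := face_facet atX.
have aX : a \in faces X := faces_down atX (subsetUl _ _).
rewrite margE divr_gt0 ?block_mass_gt0 // (bigD1 w) /=; last first.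
  rewrite /block !restr_typ // ?(subset_trans (subsetUl _ _) atw) // eqxx /=.
  by rewrite -{1}tI restr_typ // (subset_trans (subsetUr _ _) atw).
by rewrite ltr_wpDr ?weight_full //; apply: sumr_ge0 => u _; exact: weight_ge0.
Qed.

Lemma marg_ge0 a T t : 0 <= marg X a T t.
Proof. by rewrite margE divr_ge0 ?sumr_ge0 // => u _; exact: weight_ge0. Qed.

(** * Data processing and contraction on the fibres *)

Lemma condexp_block a f w : block a w ->
  condexp p (fun w => restr X w (typ X a)) f w
  = (\sum_(u | block a u) p u * f u) / block_mass a.
Proof. by move=> /eqP e; rewrite /condexp /block_mass /block e. Qed.

Lemma block_fibre a T u w : typ X a \subset T ->
  restr X u T = restr X w T -> block a u = block a w.
Proof. by move=> aT /(restr_mono aT); rewrite /block => ->. Qed.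

(** Both bounds are conditional Jensen. Averaging the density over [I] gives the upper one;
    averaging further over the whole block leaves the constant 1, whose x ln x is 0, and gives the
    lower one. *)
Lemma KL_data_processing I J a mu : [disjoint I & J] ->
  a \in faces_of X (~: (I :|: J)) -> distr_on (link_of X a I) mu ->
  0 <= KL (push mu (colored_walk X a J)) (marg X a J) <= KL mu (marg X a I).
Proof.
move=> dis aA [mu0 muL mu1].
have := aA; rewrite inE => /andP[aX /eqP aT]; have Z0 := block_mass_gt0 aX.
pose h t := mu t / marg X a I t.
have muE t : mu t = marg X a I t * h t.
  have [tL|tL] := boolP (t \in link_of X a I).
    by rewrite mulrC divfK // gt_eqF ?link_marg_gt0.
  by rewrite /h muL // mul0r mulr0.
pose f w := h (restr X w I).
have f0 w : 0 <= f w by rewrite divr_ge0 ?marg_ge0.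
have mass : \sum_(w | block a w) p w * f w = block_mass a.
  rewrite -marg_sum // -[RHS]mulr1 -mu1 [in RHS]big_mkcond /=; congr (_ * _).
  by apply: eq_bigr => t _; case: ifPn => [_|/muL <-]; rewrite -muE.
have aI : typ X a \subset ~: I by rewrite aT setCS subsetUl.
rewrite -![_ <= KL _ _](ler_pM2l Z0) mulr0 (KL_marg aX muE).
rewrite (KL_push_colored_walk dis aA muE) -/f.
apply/andP; split; last first.
  by apply: (xlnx_sum_condexp weight_ge0) => // u w; exact: block_fibre.
set g := condexp _ _ _.
have g0 w : 0 <= g w by exact: (condexp_ge0 weight_ge0).
apply: le_trans (xlnx_sum_condexp weight_ge0 (B := block a)
  (k := fun w => restr X w (typ X a)) _ g0); last by move=> u w; exact: block_fibre.
rewrite /xlnx_sum big1 // => w bw.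
rewrite condexp_tower; [|exact: weight_ge0|by move=> u v; exact: restr_mono].
by rewrite condexp_block // mass divff ?gt_eqF // xlnx1 mulr0.
Qed.

Lemma ratio_between01 (x y : R) : 0 <= x <= y -> 0 <= x / y <= 1.
Proof.
move=> /andP[x0 xy]; rewrite divr_ge0 ?(le_trans x0 xy) //=.
have := le_trans x0 xy; rewrite le_eqVlt => /orP[/eqP <-|y0].
  by rewrite invr0 mulr0.
by rewrite ler_pdivrMr ?mul1r.
Qed.

(** By data processing the ratios lie in [0, 1], so the supremum is a genuine upper bound. *)
Lemma kappa_ofP I J : [disjoint I & J] ->
  [/\ 0 <= kappa_of X I J, kappa_of X I J <= 1
    & forall a mu, a \in faces_of X (~: (I :|: J)) ->
        distr_on (link_of X a I) mu ->
        KL (push mu (colored_walk X a J)) (marg X a J)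
        <= kappa_of X I J * KL mu (marg X a I)].
Proof.
move=> dis; rewrite /kappa_of; set E := (E in sup E).
have E01 r : E r -> 0 <= r <= 1.
  move=> [a [mu [aA muL _ ->]]]; apply: ratio_between01.
  exact: KL_data_processing.
have kE r : E r -> r <= sup E.
  by apply: ub_le_sup; exists 1 => r' /E01 /andP[].
split=> [||a mu].
- by apply: sup_ge0_nonneg => r /E01 /andP[].
- by apply: sup_le_nonneg => // r /E01 /andP[].
move=> aA muL; have /andP[l0 l1] := KL_data_processing dis aA muL.
(* Such [mu] are excluded from the supremum; data processing bounds their image by 0 directly. *)
have [KL0|KL0] := eqVneq (KL mu (marg X a I)) 0.
  by rewrite KL0 mulr0 -KL0.
rewrite -ler_pdivrMr; first by apply: kE; exists a, mu.
by rewrite lt_neqAle eq_sym KL0 (le_trans l0 l1).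
Qed.

(* Homogeneity of entropy reduces an arbitrary f on the fibre of [a] to a
   probability density on the link, to which [kappa_of] applies. *)
Lemma block_contraction I J f a
    (A := ~: (I :|: J)) (B := fun w => restr X w A == a) (S := xlnx_sum p B) :
  [disjoint I & J] ->
  (forall w, 0 <= f w) ->
  (forall u w, restr X u (~: J) = restr X w (~: J) -> f u = f w) ->
  S (condexp p (fun w => restr X w (~: I)) f)
    - S (condexp p (fun w => restr X w A) f)
  <= kappa_of X I J * (S f - S (condexp p (fun w => restr X w A) f)).
Proof.
move=> dis f0 fJ; have [k0 k1 kP] := kappa_ofP dis.
have Ik u w : restr X u (~: I) = restr X w (~: I) -> B u = B w.
  by move=> /(restr_mono (S := A)) e; rewrite /B e // setCS subsetUl.
have Jensen := xlnx_sum_condexp weight_ge0 Ik f0.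
pose F := \sum_(w | B w) p w * f w.
(* If [f] has total mass zero on the fibre it cannot be normalised; then the right side is 0 and
   Jensen bounds the left one. *)
have [F0|F0] := eqVneq F 0.
  have pf0 w : B w -> p w * f w = 0.
    move=> Bw; apply: (psumr_eq0P _ F0) => // u _.
    by apply: mulr_ge0; rewrite ?weight_ge0.
  have Sf : S f = 0.
    by apply: big1 => w /pf0; rewrite /xlnx mulrA => ->; rewrite mul0r.
  have -> : S (condexp p (fun w => restr X w A) f) = 0.
    apply: big1 => w /eqP Bw; rewrite /condexp Bw -/F F0 mul0r xlnx0 mulr0 //.
  by rewrite !subr0 Sf mulr0 -[leRHS]Sf.
have [w0 Bw0 w0F] : exists2 w, B w & w \in facets X.
  have [w /andP[Bw /weight_neq0 wF]|no] := pickP (fun w => B w && (p w != 0)).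
    by exists w.
  case/eqP: F0; apply: big1 => w Bw; have := no w; rewrite Bw /= => /negbFE/eqP ->.
  by rewrite mul0r.
have aA : a \in faces_of X A by rewrite -(eqP Bw0) restr_faces_of.
have := aA; rewrite inE => /andP[aX /eqP aT].
have BE : block a = B by rewrite /block aT.
have Z0 := block_mass_gt0 aX; set Z := block_mass a in Z0.
have ZE : Z = \sum_(w | B w) p w by rewrite /Z /block_mass BE.
(* The mean of [f] on the fibre; [g] below has mean 1. *)
pose m := F / Z.
have m0 : 0 < m.
  rewrite divr_gt0 // lt_neqAle eq_sym F0 sumr_ge0 // => w _.
  by rewrite mulr_ge0 ?weight_ge0.
pose g w := f w / m.
have g0 w : 0 <= g w by rewrite divr_ge0 // ltW.
have fE w : f w = m * g w by rewrite mulrC divfK ?gt_eqF.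
have gZ : \sum_(w | B w) p w * g w = Z.
  rewrite /g; under eq_bigr do rewrite mulrA.
  by rewrite -mulr_suml -/F /m invf_div mulrCA divff ?mulr1.
(* On the fibre [g] depends only on $\omega_I$. The hypothesis [fJ] covers all vertex sets, so [g]
   can be evaluated at [a :|: t] even though this lacks the coordinates in [J]. *)
pose h t := g (a :|: t).
have gh w : B w -> g w = h (restr X w I).
  move=> /eqP Bw; rewrite /g /h /g; congr (_ / _); apply: fJ.
  rewrite -{1}Bw -restrU restr_restr.
    by [].
  by apply/subsetP => i; rewrite !inE; case: (i \in I) => //= /negbTE ->.
pose mu t := marg X a I t * h t.
have muL : distr_on (link_of X a I) mu.
  have muN t : t \notin link_of X a I -> mu t = 0.
    move=> tL; rewrite /mu margE big1 ?mul0r // => w /andP[Bw /eqP wt].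
    apply: weight_notin; apply: contra tL => wF; rewrite -wt inE restr_faces_of //=.
    by rewrite -{1}(eqP Bw) -restrU; apply: faces_down (facet_face wF) (restr_sub _ _ _).
  split=> // [t|]; first by apply: mulr_ge0; [exact: marg_ge0 | exact: g0].
  rewrite big_mkcond /=; apply: (mulfI (lt0r_neq0 Z0)).
  rewrite mulr1 -[RHS]gZ -[in RHS]BE.
  transitivity (Z * \sum_t mu t).
    by congr (_ * _); apply: eq_bigr => t _; case: ifPn => // /muN.
  by rewrite marg_sum //; apply: eq_bigr => w Bw; rewrite -gh // -BE.
have muE t : mu t = marg X a I t * h t by [].
have := kP a mu aA muL; rewrite -(ler_pM2l Z0) mulrCA.
rewrite (KL_marg aX muE) (KL_push_colored_walk dis aA muE) BE.
have -> : xlnx_sum p B (fun w => h (restr X w I)) = S g.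
  by apply: eq_bigr => w /gh ->.
have -> : xlnx_sum p B (condexp p (fun w => restr X w (~: I)) (fun w => h (restr X w I)))
    = S (condexp p (fun w => restr X w (~: I)) g).
  apply: eq_bigr => w Bw; congr (_ * xlnx _); apply: eq_condexp => u e.
  by rewrite gh // (Ik _ _ e).
(* By homogeneity the three sums share the term [xlnx m * Z], which cancels in the differences and
   leaves the common factor [m]. *)
have SA : S (condexp p (fun w => restr X w A) f) = xlnx m * Z.
  rewrite ZE mulr_sumr; apply: eq_bigr => w /eqP Bw.
  by rewrite /condexp Bw mulrC -/F -ZE.
have Sf : S f = m * S g + xlnx m * Z.
  rewrite -gZ -xlnx_sumZ // ?ltW //; apply: eq_bigr => w _.
  by rewrite fE.
have SI : S (condexp p (fun w => restr X w (~: I)) f)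
    = m * S (condexp p (fun w => restr X w (~: I)) g) + xlnx m * Z.
  rewrite -gZ -(condexp_sum weight_ge0 g Ik) -xlnx_sumZ ?ltW //; last first.
    by move=> w; apply: (condexp_ge0 weight_ge0).
  apply: eq_bigr => w _; rewrite -condexpZ; congr (_ * xlnx _).
  by apply: eq_condexp => u _; rewrite fE.
rewrite SA Sf SI !addrK [_ * (m * _)]mulrCA => h1.
by rewrite ler_pM2l.
Qed.

Lemma xlnx_sum_partition A f :
  xlnx_sum p predT f = \sum_a xlnx_sum p (fun w => restr X w A == a) f.
Proof. by rewrite /xlnx_sum (partition_big (fun w => restr X w A) predT). Qed.

(** The constant does not depend on the fibre, so the bounds for all restrictions to [A] add up. *)
Lemma condexp_contraction I J f (A := ~: (I :|: J)) (S := xlnx_sum p predT) :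
  [disjoint I & J] ->
  (forall w, 0 <= f w) ->
  (forall u w, restr X u (~: J) = restr X w (~: J) -> f u = f w) ->
  S (condexp p (fun w => restr X w (~: I)) f)
    - S (condexp p (fun w => restr X w A) f)
  <= kappa_of X I J * (S f - S (condexp p (fun w => restr X w A) f)).
Proof.
move=> dis f0 fJ; rewrite /S !(xlnx_sum_partition A) -!sumrB mulr_sumr.
by apply: ler_sum => a _; exact: block_contraction.
Qed.

(** * The sweep as iterated conditional expectation *)

Lemma push_update i f x :
  push (fun w => p w * f w) (update X i) x
  = p x * condexp p (fun w => restr X w (~: [set i])) f x.
Proof.
rewrite /condexp mulrA mulr_sumr mulr_suml [RHS]big_mkcond /=.
apply: eq_bigr => w _; rewrite /update /cPr !PrE.
(* The kernel entry is [p x] over the mass of the common fibre, or 0 when [w] and [x] differ off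
   [i]. *)
have [wx|wx] := eqVneq (restr X w (~: [set i])) (restr X x (~: [set i])).
  rewrite (eq_bigl (pred1 x)) ?big_pred1_eq ?wx => [|u /=]; first by ring.
  by case: eqP => // ->; rewrite ?wx eqxx.
rewrite big_pred0 ?mul0r ?mulr0 // => u.
by case: eqP => // ->; rewrite eq_sym (negbTE wx).
Qed.

(** A left fold, because distributions act on the left: the first kernel of the product is applied
    first. *)
Definition sweep (r : seq 'I_n) f : {set V} -> R :=
  foldl (fun f i => condexp p (fun w => restr X w (~: [set i])) f) f r.

Lemma push_sweep (r : seq 'I_n) mu f : (forall w, mu w = p w * f w) ->
  forall x, push mu (\big[@kcomp R {set V} / @kid R {set V}]_(i <- r) update X i) x
    = p x * sweep r f x.
Proof.
elim: r mu f => [|i r IH] mu f muE x.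
  rewrite big_nil /push /kid (bigD1 x) //= eqxx mulr1 big1 ?addr0 // => w.
  by move=> /negbTE ->; rewrite mulr0.
rewrite big_cons /= -(IH (push mu (update X i))) => [|w].
  exact: push_kcomp.
by rewrite -push_update; apply: eq_bigr => y _; rewrite muE.
Qed.

Definition prefix_set (s : {perm 'I_n}) (m : nat) : {set 'I_n} :=
  [set s k | k in [set k : 'I_n | (k < m)%N]].

(** The last position contributes no factor; at [m = 0] this is the product in the theorem. *)
Definition suffix_eta (s : {perm 'I_n}) (m : nat) : R :=
  \prod_(j < n | (m <= j)%N && (j.+1 < n)%N)
     eta_of X [set s k | k in [set k : 'I_n | (j < k)%N]] [set s j].

Lemma in_perm_image (s : {perm 'I_n}) (P : pred 'I_n) i :
  (i \in [set s k | k in [set k | P k]]) = P ((s^-1)%g i).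
Proof. by rewrite -{1}[i](permKV s) mem_imset ?inE //; exact: perm_inj. Qed.

Lemma prefix_setS (s : {perm 'I_n}) (m : nat) :
  prefix_set s m.+1 = ~: [set s k | k in [set k : 'I_n | (m < k)%N]].
Proof. by apply/setP => i; rewrite inE !in_perm_image -leqNgt. Qed.

Lemma prefix_setE (s : {perm 'I_n}) (j : 'I_n) :
  prefix_set s j
  = ~: ([set s k | k in [set k : 'I_n | (j < k)%N]] :|: [set s j]).
Proof.
apply/setP => i; rewrite in_setC in_setU in_set1 !in_perm_image.
rewrite negb_or -leqNgt -(inj_eq (@perm_inj _ s^-1%g)) permK -val_eqE /=; lia.
Qed.

Lemma prefix_set_full (s : {perm 'I_n}) : prefix_set s n = setT.
Proof. by apply/setP => i; rewrite in_perm_image ltn_ord inE. Qed.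

(** The factor [p w] absorbs the default value of [condexp] at points of weight zero. *)
Lemma condexp_setT f w : p w * xlnx (condexp p (fun u => restr X u setT) f w)
  = p w * xlnx (f w).
Proof.
have ew u : (restr X u setT == restr X w setT) = pred1 w u by rewrite !restrT.
rewrite /condexp !(eq_bigl _ _ ew) !big_pred1_eq.
have [->|pw] := eqVneq (p w) 0; first by rewrite !mul0r.
by rewrite mulrAC divff ?mul1r.
Qed.

(** Induction on the number of positions left. The range of the product is carried along because the
    final estimate multiplies inequalities by it and by its complement to 1. *)
Lemma sweep_contraction (s : {perm 'I_n}) (m : nat) f
    (S := xlnx_sum p predT) (A := prefix_set s m) :
  (m <= n)%N -> (forall w, 0 <= f w) ->
  0 <= suffix_eta s m <= 1 /\
  S (sweep [seq s j | j <- drop m (enum 'I_n)] f)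
    - S (condexp p (fun w => restr X w A) f)
  <= (1 - suffix_eta s m) * (S f - S (condexp p (fun w => restr X w A) f)).
Proof.
rewrite {}/A => mn.
have [d dm] : exists d, (n = d + m)%N by exists (n - m)%N; rewrite subnK.
elim: d => [|d IH] in m mn dm f * => f0.
  have {dm} -> : m = n by rewrite dm.
  rewrite /suffix_eta big_pred0 => [|j]; last by rewrite leqNgt ltn_ord.
  rewrite drop_oversize ?size_enum_ord //= ler01 lexx; split=> //.
  rewrite prefix_set_full subrr mul0r subr_le0 /S /xlnx_sum.
  by rewrite (eq_bigr _ (fun w _ => condexp_setT f w)).
have mn' : (m < n)%N by rewrite dm addSn ltnS leq_addl.
pose j := Ordinal mn'.
rewrite (drop_nth j) ?size_enum_ord //= (nth_ord_enum j j) -/(sweep _ _).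
set g := condexp _ _ f.
have g0 w : 0 <= g w by exact: (condexp_ge0 weight_ge0).
have [|/andP[c0 c1] {}IH] := IH m.+1 mn' _ g g0; first by rewrite dm addSnnS.
pose I := [set s k | k in [set k : 'I_n | (m < k)%N]].
have AE : prefix_set s m = ~: (I :|: [set s j]) by exact: (prefix_setE s j).
have dis : [disjoint I & [set s j]].
  by rewrite disjoint_sym disjoints1 in_perm_image permK ltnn.
(* The last position has the factor 1, as no coordinate remains to be reached. *)
pose e := if (m.+1 < n)%N then eta_of X I [set s j] else 1.
have cE : suffix_eta s m = e * suffix_eta s m.+1.
  rewrite /suffix_eta /e; case: ifP => mn2.
    rewrite (bigD1 j) /= ?leqnn //; congr (_ * _); apply: eq_bigl => i.
    by rewrite -val_eqE /=; lia.
  rewrite !big_pred0 ?mulr1 // => i; have := ltn_ord i; lia.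
have [k0 k1 _] := kappa_ofP dis.
have /andP[e0 e1] : 0 <= e <= 1.
  by rewrite /e /eta_of; case: ifP => _; rewrite ?ler01 ?lexx //; lra.
have AsubJ : prefix_set s m \subset ~: [set s j] by rewrite AE setCS subsetUr.
(* The tower property: coordinate [s j] is not in the prefix, so averaging over it first changes
   nothing. *)
have <- : S (condexp p (fun w => restr X w (prefix_set s m)) g)
    = S (condexp p (fun w => restr X w (prefix_set s m)) f).
  apply: eq_bigr => w _; congr (_ * xlnx _).
  by apply: (condexp_tower weight_ge0) => u v; exact: restr_mono.
have Jensen (h : {set V} -> R) T : (forall w, 0 <= h w) ->
    S (condexp p (fun w => restr X w T) h) <= S h.
  by move=> h0; apply: (xlnx_sum_condexp weight_ge0).
have step : S (condexp p (fun w => restr X w (prefix_set s m.+1)) g)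
    - S (condexp p (fun w => restr X w (prefix_set s m)) g)
  <= (1 - e) * (S g - S (condexp p (fun w => restr X w (prefix_set s m)) g)).
  rewrite /e; case: ifP => mn2.
    rewrite /eta_of subKr prefix_setS AE; apply: condexp_contraction => // u w uw.
    exact: (condexp_fibre p f uw).
  (* At the last position the prefix is everything but [s j], so [g] is already a function of it and
     Jensen suffices. *)
  rewrite subrr mul0r subr_le0.
  have -> : S (condexp p (fun w => restr X w (prefix_set s m)) g) = S g.
    apply: eq_bigr => w _; congr (_ * xlnx _).
    suff -> : prefix_set s m = ~: [set s j].
      by apply: (condexp_tower weight_ge0).
    rewrite AE; congr (~: _); apply/setUidPr/subsetP => i; rewrite in_perm_image.
    have := ltn_ord ((s^-1)%g i); lia.
  exact: Jensen.
have := Jensen f (~: [set s j]) f0; rewrite -/g.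
move: step IH (Jensen g (prefix_set s m) g0) c0 c1 e0 e1.
rewrite cE; set c' := suffix_eta s m.+1.
set x := S g; set y := S f; set z := S (sweep _ _).
set a := S (condexp _ _ _); set b := S (condexp _ _ _) => hab hz hbx c0 c1 e0 e1 xy.
have ec0 : 0 <= e * c' by exact: mulr_ge0.
have ec1 : e * c' <= 1 by exact: mulr_ile1.
split; first by rewrite ec0 ec1.
(* The chain is z - b <= (1 - c')(x - b) + c'(a - b) <= (1 - e c')(x - b) <= (1 - e c')(y - b). *)
have h1 : c' * (a - b) <= c' * ((1 - e) * (x - b)) by exact: ler_wpM2l.
have h2 : (1 - e * c') * x <= (1 - e * c') * y by apply: ler_wpM2l => //; rewrite subr_ge0.
lra.
Qed.

(** * From densities to the entropy contraction factor *)

Lemma KL_weight mu f : (forall w, mu w = p w * f w) ->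
  KL mu p = xlnx_sum p predT f.
Proof. exact: KL_density. Qed.

Lemma EC_ge P c : 0 <= c <= 1 ->
  (forall mu, distr_on (facets X) mu ->
     0 <= KL mu p /\ KL (push mu P) p <= (1 - c) * KL mu p) ->
  c <= EC X P.
Proof.
move=> /andP[c0 c1] KLc; rewrite lerBrDl -lerBrDr; apply: sup_le_nonneg.
  by rewrite subr_ge0.
move=> _ [mu [muF KL0 ->]]; have [KLge KLle] := KLc mu muF.
by rewrite ler_pdivrMr // lt_neqAle eq_sym KL0.
Qed.

End Weighted.

Theorem theorem4p1 (R : realType) (n : nat) (V : finType)
    (X : weighted_complex R n V) (s : {perm 'I_n}) :
  \prod_(j < n | (j.+1 < n)%N)
     eta_of X [set s k | k in [set k : 'I_n | (j < k)%N]] [set s j]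
  <= EC X (seq_sweep X s).
Proof.
pose p := weight X.
have p0 := @weight_ge0 R n V X.
rewrite -/(suffix_eta X s 0).
(* The constant density 1 serves only to extract the range of the product from
   [sweep_contraction]. *)
have f01 (w : {set V}) : 0 <= (1 : R) by exact: ler01.
apply: EC_ge => [|mu [mu0 muF mu1]].
  by have [] := sweep_contraction X s (leq0n n) f01.
pose f w := mu w / p w.
have f0 w : 0 <= f w by exact: divr_ge0.
have muE w : mu w = p w * f w.
  have [wF|/[dup] wF /muF ->] := boolP (w \in facets X).
    by rewrite mulrC divfK // gt_eqF ?weight_full.
  by rewrite /p weight_notin ?mul0r.
have mass : \sum_w p w * f w = 1.
  rewrite -mu1 [RHS]big_mkcond; apply: eq_bigr => w _; rewrite -muE.
  by case: ifPn => // /muF.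
have pre0 : prefix_set s 0 = set0.
  by apply/setP => i; rewrite in_perm_image inE.
(* Given no coordinates the conditional expectation is the total mass 1, so the entropy of [f] is
   the full divergence of [mu]. *)
have E0 : xlnx_sum p predT (condexp p (fun w => restr X w (prefix_set s 0)) f) = 0.
  apply: big1 => w _; rewrite pre0 /condexp restr0.
  have e u : (restr X u set0 == set0) = true by rewrite restr0 eqxx.
  by rewrite !(eq_bigl _ _ e) mass (weight_sum X) divr1 xlnx1 mulr0.
have [_] := sweep_contraction X s (leq0n n) f0.
rewrite E0 !subr0 drop0 -(KL_weight muE) => le_sweep; split.
  rewrite (KL_weight muE) -[leLHS]E0; exact: xlnx_sum_condexp.
apply: le_trans le_sweep; rewrite le_eqVlt; apply/orP; left; apply/eqP.
apply: KL_weight => w; rewrite -(push_sweep _ muE); congr (push mu _ w).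
by rewrite big_map enumT /seq_sweep; unlock index_enum.
Qed.
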